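(* Let $\mathfrak{u}(t)=\{u^{(j)}(t)\}_{j=1}^J$ be a solution of the TEKI flow, taking values in $\mathcal{A}^J$, with initial ensemble $\{u^{(j)}(0)\}_{j=1}^J\subset K$ such that $C(\mathfrak{u}(0))\neq 0$. Then for every $t\ge 0$ up to which the solution exists, $$\|C(\mathfrak{u}(t))\|_X\le \frac{1}{\|C(\mathfrak{u}(0))\|_X^{-1}+2\lambda_m t}.$$ Here $\|C(\mathfrak{u}(t))\|_X$ is the operator norm of $C(\mathfrak{u}(t))$ as a linear operator on $(\mathcal{A},\|\cdot\|_X)$, and $\lambda_m=\inf_{v\in\mathcal{A},\ \|v\|_X^2=1}\|v\|_K^2$.
   Context: $X,Y$ are real separable Hilbert spaces, $y\in Y$ is fixed, and $J$ is a positive integer. $\Gamma$ is a bounded, self-adjoint, strictly positive operator on $Y$ with $\Gamma^{-1/2}$ bounded. $C_0$ is a trace-class, self-adjoint, strictly positive-definite operator on $X$. $K$ is the Cameron-Martin space: $K$ is the domain of $C_0^{-1/2}$, with inner product $\langle a,b\rangle_K=\langle C_0^{-1/2}a,C_0^{-1/2}b\rangle_X$ and norm $\|a\|_K=\|C_0^{-1/2}a\|_X$. The forward map $G:K\to Y$ is $C^1$ (possibly nonlinear). For $\mathfrak{u}=\{u^{(j)}\}_{j=1}^J$ in $K^J$ put $\bar u=\frac1J\sum_m u^{(m)}$, $\bar G=\frac1J\sum_m G(u^{(m)})$ and $$E_{jk}(\mathfrak{u})=\langle\Gamma^{-1/2}(G(u^{(j)})-y),\Gamma^{-1/2}(G(u^{(k)})-\bar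 G)\rangle_Y+\langle u^{(j)},u^{(k)}-\bar u\rangle_K.$$ The TEKI flow (Tikhonov ensemble Kalman inversion in continuous time, regularization parameter equal to $1$) is the ODE system $$\frac{du^{(j)}}{dt}=-\frac1J\sum_{k=1}^J E_{jk}(\mathfrak{u})\,(u^{(k)}-\bar u),\qquad j=1,\dots,J.$$ $\mathcal{A}$ denotes the (finite-dimensional) linear span of the initial ensemble $\{u^{(j)}(0)\}_{j=1}^J\subset K$. The empirical covariance is $C(\mathfrak{u})=\frac1J\sum_{m=1}^J(u^{(m)}-\bar u)\otimes(u^{(m)}-\bar u)$, i.e. $C(\mathfrak{u})v=\frac1J\sum_{m}\langle v,u^{(m)}-\bar u\rangle_X(u^{(m)}-\bar u)$; it maps $\mathcal{A}$ to $\mathcal{A}$ when $\mathfrak{u}\in\mathcal{A}^J$. *)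

(* Defs.v *)
From HB Require Import structures.
From mathcomp Require Import all_boot all_order all_algebra.
From mathcomp Require Import all_classical all_reals all_analysis.

Set Implicit Arguments.
Unset Strict Implicit.
Unset Printing Implicit Defensive.

Import Order.TTheory GRing.Theory Num.Theory.
Import numFieldNormedType.Exports.

Local Open Scope classical_set_scope.
Local Open Scope ring_scope.

HB.mixin Record NormedModule_isInnerProduct (R : realType) V
    of NormedModule R V := {
  inner : V -> V -> R ;
  innerC : forall x y, inner x y = inner y x ;
  innerDl : forall x y z, inner (x + y) z = inner x z + inner y z ;
  innerZl : forall a x y, inner (a *: x) y = a * inner x y ;
  normr_inner : forall x, `|x| ^+ 2 = inner x x
}.

#[short(type="innerProductType")]
HB.structure Definition InnerProduct (R : realType) :=
  {V of NormedModule R V & NormedModule_isInnerProduct R V}.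

#[short(type="hilbertType")]
HB.structure Definition Hilbert (R : realType) :=
  {V of CompleteNormedModule R V & NormedModule_isInnerProduct R V}.

Definition separable (T : topologicalType) : Prop :=
  exists2 D : set T, countable D & dense D.

Section Operators.
Context {R : realType}.

(* Norm of a map f as an operator on the linear subspace A. *)
Definition opnorm_on (V W : normedModType R) (A : set V) (f : V -> W) : R :=
  sup [set `|f x| | x in [set x | A x /\ `|x| <= 1]].

Definition C1 (V W : normedModType R) (G : V -> W) : Prop :=
  (forall x, differentiable G x) /\
  forall x, opnorm_on setT ('d G z \- 'd G x) @[z --> x] --> (0 : R).

Context {X : hilbertType R}.
Implicit Types S T P : {linear X -> X}.

Definition bounded_op T : Prop := bounded_near T (nbhs (0 : X)).

Definition self_adjoint T : Prop := forall x y, inner (T x) y = inner x (T y).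

Definition nonneg_op T : Prop := forall x, 0 <= inner (T x) x.

Definition strictly_positive T : Prop :=
  forall x, x != 0 -> 0 < inner (T x) x.

(* S = T^{1/2}; it exists and is unique when T is bounded, self-adjoint and
   nonnegative. *)
Definition is_sqrt_op S T : Prop :=
  [/\ bounded_op S, self_adjoint S, nonneg_op S & forall x, S (S x) = T x].

(* N = T^{-1/2}, defined on the whole space. *)
Definition is_inv_sqrt_op (N T : {linear X -> X}) : Prop :=
  exists S, [/\ is_sqrt_op S T, cancel S N & cancel N S].

Definition orthonormal_basis (E : set X) : Prop :=
  (forall e f, E e -> E f -> inner e f = (e == f)%:R) /\
  (forall x, (forall e, E e -> inner x e = 0) -> x = 0).

(* P = |T|: the condition on inner products says P^2 = T^* T. *)
Definition is_abs_op P T : Prop :=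
  [/\ bounded_op P, self_adjoint P, nonneg_op P &
      forall x y, inner (P x) (P y) = inner (T x) (T y)].

Definition trace_class T : Prop :=
  bounded_op T /\
  exists P, is_abs_op P T /\
    exists2 E, orthonormal_basis E &
      (\esum_(e in E) (inner (P e) e)%:E < +oo)%E.

End Operators.

(* C_0 bundled with C_0^{1/2}, which C_0 determines. *)
Record covOp (R : realType) (X : hilbertType R) := CovOp {
  cov_op : {linear X -> X} ;
  cov_sqrt : {linear X -> X} ;
  cov_trace_class : trace_class cov_op ;
  cov_self_adjoint : self_adjoint cov_op ;
  cov_strictly_positive : strictly_positive cov_op ;
  cov_sqrtP : is_sqrt_op cov_sqrt cov_op
}.

(* The Cameron-Martin space K: the domain of C_0^{-1/2} is the range of
   C_0^{1/2}. *)
Record cameronMartin (R : realType) (X : hilbertType R) (C0 : covOp X) :=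
  CameronMartin { cm_val : X ; cm_valP : cm_val \in range (cov_sqrt C0) }.

Section CameronMartinTheory.
Context {R : realType} {X : hilbertType R} {C0 : covOp X}.
Local Notation K := (cameronMartin C0).
Local Notation S := (cov_sqrt C0).

HB.instance Definition _ := [isSub for @cm_val R X C0].
HB.instance Definition _ := [Choice of K by <:].

Lemma cov_range_submod_closed :
  submod_closed (fun x : X => x \in range S).
Proof.
split; first by apply/mem_set; exists 0 => //; rewrite linear0.
move=> a _ _ /set_mem [x _ <-] /set_mem [y _ <-]; apply/mem_set.
by exists (a *: x + y) => //; rewrite linearP.
Qed.

HB.instance Definition _ :=
  GRing.SubChoice_isSubLmodule.Build R X _ K cov_range_submod_closed.

Lemma cov_sqrt_inj : injective S.
Proof.
move=> x y Sxy; apply/eqP; rewrite -subr_eq0; apply/negPn/negP => nz.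
have := @cov_strictly_positive _ _ C0 _ nz.
have [_ _ _ SS] := cov_sqrtP C0.
rewrite -SS linearB/= Sxy subrr linear0 -(scale0r (0 : X)) innerZl mul0r.
by rewrite ltxx.
Qed.

(* C_0^{-1/2} *)
Definition cov_inv_sqrt (a : K) : X := xget 0 [set z | S z = cm_val a].

Lemma cov_inv_sqrtK (a : K) : S (cov_inv_sqrt a) = cm_val a.
Proof.
have /set_mem[z _ Sz] := cm_valP a.
exact: (@xgetPex _ 0 [set z | S z = cm_val a] (ex_intro _ z Sz)).
Qed.

Lemma cov_inv_sqrt_linear : linear cov_inv_sqrt.
Proof.
by move=> c a b; apply: cov_sqrt_inj; rewrite linearP !cov_inv_sqrtK.
Qed.

HB.instance Definition _ :=
  GRing.isLinear.Build R K X _ cov_inv_sqrt cov_inv_sqrt_linear.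

Definition cm_norm (a : K) : R := `|cov_inv_sqrt a|.

Definition cm_inner (a b : K) : R := inner (cov_inv_sqrt a) (cov_inv_sqrt b).

Lemma cm_ler_normD (a b : K) : cm_norm (a + b) <= cm_norm a + cm_norm b.
Proof. by rewrite /cm_norm linearD ler_normD. Qed.

Lemma cm_normrZ (c : R) (a : K) : cm_norm (c *: a) = `|c| * cm_norm a.
Proof. by rewrite /cm_norm linearZ normrZ. Qed.

Lemma cm_normr0_eq0 (a : K) : cm_norm a = 0 -> a = 0.
Proof.
move=> /normr0_eq0 a0; apply: val_inj.
by rewrite /= -cov_inv_sqrtK a0 !linear0.
Qed.

HB.instance Definition _ :=
  Lmodule_isNormed.Build R K cm_ler_normD cm_normrZ cm_normr0_eq0.

Lemma cm_innerC (a b : K) : cm_inner a b = cm_inner b a.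
Proof. exact: innerC. Qed.

Lemma cm_innerDl (a b c : K) :
  cm_inner (a + b) c = cm_inner a c + cm_inner b c.
Proof. by rewrite /cm_inner linearD innerDl. Qed.

Lemma cm_innerZl (c : R) (a b : K) :
  cm_inner (c *: a) b = c * cm_inner a b.
Proof. by rewrite /cm_inner linearZ innerZl. Qed.

Lemma cm_normr_inner (a : K) : `|a| ^+ 2 = cm_inner a a.
Proof. exact: normr_inner. Qed.

HB.instance Definition _ :=
  NormedModule_isInnerProduct.Build R K
    cm_innerC cm_innerDl cm_innerZl cm_normr_inner.

End CameronMartinTheory.

Section TEKI.
Context {R : realType} {X Y : hilbertType R} {C0 : covOp X} {J : nat}.
Local Notation K := (cameronMartin C0).

Definition emean (V : lmodType R) (u : 'I_J -> V) : V :=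
  J%:R^-1 *: \sum_(m < J) u m.

(* Gmh stands for Gamma^{-1/2}. *)
Definition teki_E (Gmh : Y -> Y) (G : K -> Y) (y : Y) (u : 'I_J -> K)
    (j k : 'I_J) : R :=
  inner (Gmh (G (u j) - y)) (Gmh (G (u k) - emean (G \o u)))
  + inner (u j) (u k - emean u).

Definition teki_rhs (Gmh : Y -> Y) (G : K -> Y) (y : Y) (u : 'I_J -> K)
    (j : 'I_J) : K :=
  - (J%:R^-1 *: \sum_(k < J) teki_E Gmh G y u j k *: (u k - emean u)).

(* Derivatives are taken relative to I (hence one-sided at the endpoints of
   I) and in the norm of K. *)
Definition teki_solution (Gmh : Y -> Y) (G : K -> Y) (y : Y)
    (I : set R) (u : R -> 'I_J -> K) : Prop :=
  forall s, I s -> forall j,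
    (r - s)^-1 *: (u r j - u s j) @[r --> within I s^']
      --> teki_rhs Gmh G y (u s) j.

Definition ensemble_span (u : 'I_J -> K) : set K :=
  [set v | exists c : 'I_J -> R, v = \sum_(j < J) c j *: u j].

Definition empirical_cov (u : 'I_J -> K) (v : X) : X :=
  J%:R^-1 *: \sum_(m < J)
    inner v (cm_val (u m - emean u)) *: cm_val (u m - emean u).

(* The norm of C(u) on (A, |.|_X). *)
Definition empirical_cov_norm (A : set K) (u : 'I_J -> K) : R :=
  opnorm_on [set cm_val v | v in A] (empirical_cov u).

Definition lambda_m (A : set K) : R :=
  inf [set `|v| ^+ 2 | v in [set v : K | A v /\ `|cm_val v| ^+ 2 = 1]].

End TEKI.

(* Main.v *)
Require Import Defs.
From HB Require Import structures.
From mathcomp Require Import all_boot all_order all_algebra.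
From mathcomp Require Import all_classical all_reals all_analysis.
From mathcomp Require Import ring.

Set Implicit Arguments.
Unset Strict Implicit.
Unset Printing Implicit Defensive.

Import Order.TTheory GRing.Theory Num.Theory.
Import numFieldNormedType.Exports.

Local Open Scope classical_set_scope.
Local Open Scope ring_scope.

(** For a fixed vector [v] of [A] with |v|_X = 1, follow the scalar function
q(s) = <C(u(s)) v, v>_X = J^-1 sum_m <v, e_m>_X^2, where e_m = u_m - ubar.

The weights a_m = <v, e_m>_X sum to zero. Differentiating q therefore only
brings in sum_m a_m <v, u_m'>_X, the motion of the mean being averaged out,
and in the double sum of the a_m a_k E_mk the data [y] and the mean of the
G(u_m) can be replaced by any other vector. What remains is the sum of two squares,
|sum_m a_m Gmh G(u_m)|_Y^2 + |sum_m a_m u_m|_K^2; the second is J^2 |C v|_K^2,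
so that q' <= - 2 |C v|_K^2 whatever the forward map is
([teki_dissipation], [cov_quad_derive]).

Since C v lies in [A], |C v|_K^2 >= lambda_m |C v|_X^2 ([lambda_m_le]), and
|C v|_X >= <C v, v>_X = q by Cauchy-Schwarz. Hence q' <= - 2 lambda_m q^2, and
this Riccati inequality is integrated by observing that 1/q - 2 lambda_m s is
nondecreasing ([riccati_le]). The initial value q(0) is at most the norm of
C(u(0)), which gives the stated bound for q(t).

Finally C(u(t)) is symmetric and nonnegative, so its norm on [A] is the
supremum of q(t) over the unit vectors of [A] ([empirical_cov_norm_le]).
As [v] is fixed in time, only scalar functions are differentiated, and the
supremum over [v] is taken at the end. *)

(** * Bilinear forms and inner products *)

Section InnerProductTheory.
Context {R : realType} {V : innerProductType R}.
Implicit Types v w : V.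

Lemma innerDr v w1 w2 : inner v (w1 + w2) = inner v w1 + inner v w2.
Proof. by rewrite innerC innerDl !(innerC v). Qed.

Lemma innerZr a v w : inner v (a *: w) = a * inner v w.
Proof. by rewrite innerC innerZl innerC. Qed.

Lemma inner_is_scalar v : scalar (inner v).
Proof. by move=> a w1 w2; rewrite innerDr innerZr. Qed.

HB.instance Definition _ v :=
  GRing.isLinear.Build R V R *%R (inner v) (inner_is_scalar v).

Lemma inner_suml (J : finType) (w : J -> V) v :
  inner (\sum_j w j) v = \sum_j inner (w j) v.
Proof. by rewrite innerC linear_sum; apply: eq_bigr => j _; rewrite innerC. Qed.

End InnerProductTheory.

(** Stated for nonnegative forms that may be degenerate: it is applied to
inner products and to <C v, w>, whose kernel is large. *)
Lemma form_CauchySchwarz (R : realFieldType) (V : lmodType R)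
    (b : V -> {scalar V}) :
  (forall v w, b v w = b w v) -> (forall v, 0 <= b v v) ->
  forall v w, b v w ^+ 2 <= b v v * b w w.
Proof.
move=> bC b0 v w.
have bE x y : b (x *: v + y *: w) (x *: v + y *: w)
    = x ^+ 2 * b v v + 2 * x * y * b v w + y ^+ 2 * b w w.
  rewrite linearD !linearZ/= !(bC (_ + _)) !linearD !linearZ/= (bC w v).
  by ring.
have [w0|w0] := eqVneq (b w w) 0; last first.
  (* the minimizer of the quadratic y |-> b (v + y w) (v + y w), rescaled *)
  have w_gt0 : 0 < b w w by rewrite lt_def w0 b0.
  rewrite -subr_ge0 -(pmulr_rge0 _ w_gt0).
  have := b0 (b w w *: v + (- b v w) *: w); rewrite bE.
  by congr (0 <= _); ring.
(* If b w w = 0, the form is affine along w; this multiple of w makes its value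
   - (b v w)^2, which forces b v w = 0. *)
have := b0 (b v w *: v + (- ((b v v + 1) / 2)) *: w).
rewrite bE w0 !mulr0 addr0 -oppr_ge0.
by congr (0 <= _); field.
Qed.

Lemma norm_inner_le (R : realType) (V : innerProductType R) (v w : V) :
  `|inner v w| <= `|v| * `|w|.
Proof.
have inner_ge0 (x : V) : 0 <= inner x x by rewrite -normr_inner sqr_ge0.
have := form_CauchySchwarz (b := fun v => inner v : {scalar V})
  (@innerC R V) inner_ge0 v w.
rewrite /= -!normr_inner -exprMn => CS.
by rewrite -(ler_pXn2r (ltn0Sn 1)) ?nnegrE ?mulr_ge0// real_normK ?num_real.
Qed.

(** * One-sided difference quotients and a Riccati inequality *)

Section DifferenceQuotients.
Context {R : realType}.

(** [q] is nonincreasing, so either q(t) <= 0, or [q] is positive on the whole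
interval; in the latter case 1/q - c s has derivative - q'/q^2 - c >= 0. *)
Lemma riccati_le (q : R -> R) (c N t : R) :
  0 <= c -> 0 < N -> 0 <= t ->
  {within `[0, t], continuous q} ->
  (forall s, s \in `]0, t[ ->
    exists2 dq, is_derive s 1 q dq & dq <= - (c * q s ^+ 2)) ->
  q 0 <= N -> q t <= 1 / (N^-1 + c * t).
Proof.
move=> c0 N0 t0 qC qD q0N.
have den_gt0 : 0 < N^-1 + c * t by rewrite ltr_pwDl ?invr_gt0 ?mulr_ge0.
have [qt0|qt0] := leP (q t) 0.
  by rewrite (le_trans qt0)// mul1r invr_ge0 ltW.
have t_in : t \in `[0, t] by rewrite in_itv/= t0 lexx.
have z_in : (0 : R) \in `[0, t] by rewrite in_itv/= t0 lexx.
have q_gt0 s : s \in `[0, t] -> 0 < q s.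
  move=> s_in; apply: (lt_le_trans qt0).
  apply: (@ler0_derive1_le _ q 0 t _ _ true false) => // [r r_in|r r_in|].
  - by have [dq Dr _] := qD _ r_in; exact: ex_derive.
  - have [dq Dr dq_le] := qD _ r_in; rewrite derive1E derive_val.
    by rewrite (le_trans dq_le)// oppr_le0 mulr_ge0// sqr_ge0.
  - by move: s_in; rewrite in_itv/= => /andP[].
pose h s := (q s)^-1 - c * s.
have hD s : s \in `]0, t[ -> exists2 dh, is_derive s 1 h dh & 0 <= dh.
  move=> s_in; have [dq Ds dq_le] := qD _ s_in.
  have qs_gt0 : 0 < q s by rewrite q_gt0// subset_itv_oo_cc.
  have Dinv := is_deriveV (lt0r_neq0 qs_gt0) Ds.
  exists (- (q s) ^- 2 * dq - c).
    have -> : h = (fun r => (q r)^-1) - (c \*: id) by [].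
    by apply: is_derive_eq; rewrite /GRing.scale/= mulr1.
  by rewrite subr_ge0 mulNr -mulrN ler_pdivlMl ?exprn_gt0// lerNr mulrC.
have : h 0 <= h t.
  apply: (@ger0_derive1_le _ h 0 t _ _ true false) => // [r r_in|r r_in|].
  - by have [dh Dr _] := hD _ r_in; exact: ex_derive.
  - by have [dh Dr dh_ge0] := hD _ r_in; rewrite derive1E derive_val.
  - apply/subspace_continuousP => x x_in; apply: cvgB; last first.
      by apply: cvgM; [exact: cvg_cst|exact: cvg_within].
    apply: cvgV; first by rewrite gt_eqF// q_gt0.
    by move/subspace_continuousP : qC; exact.
rewrite /h mulr0 subr0 lerBrDr => hle.
rewrite mul1r -[q t]invrK lef_pV2 ?posrE ?invr_gt0//.
apply: le_trans hle; rewrite lerD2r lef_pV2 ?posrE//; exact: q_gt0.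
Qed.

(** Relative differentiability gives continuity up to the endpoints of the
interval, which the mean value theorem needs. *)
Lemma cvg_slope_continuous (I : set R) (V : normedModType R) (f : R -> V)
    (s : R) (d : V) :
  (r - s)^-1 *: (f r - f s) @[r --> within I s^'] --> d ->
  f r @[r --> within I (nbhs s)] --> f s.
Proof.
move=> fD.
have f_dnbhs : f r @[r --> within I s^'] --> f s.
  have : (r - s) *: ((r - s)^-1 *: (f r - f s)) + f s @[r --> within I s^']
      --> (s - s) *: d + f s.
    apply: cvgD; last exact: cvg_cst.
    apply: cvgZ fD; apply: cvgB; last exact: cvg_cst.
    move=> B sB; apply: filterS (nbhs_dnbhs sB) => r Br _; exact: Br.
  rewrite subrr scale0r add0r; apply: cvg_trans; apply: near_eq_cvg => /=.
  near=> r.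
  have r_neq_s : r != s.
    near: r; rewrite near_withinE; near=> z => _.
    near: z; exact: nbhs_dnbhs_neq.
  by rewrite scalerA divff ?subr_eq0// scale1r subrK.
move=> B sB; have := f_dnbhs B sB; have Bs := nbhs_singleton sB.
change (nbhs s [set r | r != s -> I r -> B (f r)] ->
        nbhs s [set r | I r -> B (f r)]).
apply: filterS => r rB Ir.
by have [->//|rs] := eqVneq r s; exact: rB.
Unshelve. all: by end_near. Qed.

(** At interior points the relative derivative is the two-sided one. *)
Lemma cvg_slope_is_derive (I : set R) (V : normedModType R) (f : R -> V)
    (s : R) (d : V) :
  nbhs s I ->
  (r - s)^-1 *: (f r - f s) @[r --> within I s^'] --> d ->
  is_derive s 1 f d.
Proof.
move=> sI fD.
have shiftI : h + s @[h --> 0^'] --> within I s^'.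
  move=> B sB.
  have {}sB : nbhs s [set r | r != s -> I r -> B r] by exact: sB.
  have hs : h + s @[h --> (0 : R)] --> s.
    rewrite -[X in _ --> X]add0r.
    by apply: cvgD; [exact: cvg_id|exact: cvg_cst].
  have hIB : nbhs (0 : R)
      [set h | I (h + s) /\ (h + s != s -> I (h + s) -> B (h + s))].
    have : nbhs s (I `&` [set r | r != s -> I r -> B r]) by exact: filterI.
    by move/hs.
  change (nbhs (0 : R) [set h | h != 0 -> B (h + s)]).
  apply: filterS hIB => h [Ih Bh] h0; apply: Bh => //.
  by rewrite -subr_eq0 addrK.
have fD' : h^-1 *: (f (h *: 1 + s) - f s) @[h --> 0^'] --> d.
  apply: cvg_trans (cvg_comp _ _ shiftI fD); apply: near_eq_cvg.
  by apply: nearW => h /=; rewrite addrK [h *: 1]mulr1.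
split; first by apply: cvgP fD'.
exact: cvg_lim fD'.
Qed.

End DifferenceQuotients.

(** * The empirical covariance as a quadratic form *)

Section Ensemble.
Context {R : realType} {X : hilbertType R} {C0 : covOp X} {J : nat}.
Local Notation K := (cameronMartin C0).
Implicit Types (u : 'I_J -> K) (v w : X).

Lemma sum_sub_emean (V : lmodType R) (w : 'I_J -> V) : (0 < J)%N ->
  \sum_j (w j - emean w) = 0.
Proof.
move=> J0; rewrite sumrB sumr_const card_ord /emean -scaler_nat scalerA.
by rewrite divff ?scale1r ?subrr// pnatr_eq0 -lt0n.
Qed.

(** Weights of zero sum do not see a common translation. *)
Lemma sum_shift (V : lmodType R) (a : 'I_J -> R) (w : 'I_J -> V) (c : V) :
  \sum_j a j = 0 -> \sum_j a j *: (w j - c) = \sum_j a j *: w j.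
Proof.
move=> a0; under eq_bigr do rewrite scalerBr.
by rewrite sumrB -scaler_suml a0 scale0r subr0.
Qed.

Lemma inner_sum2 (V : innerProductType R) (a : 'I_J -> R) (w1 w2 : 'I_J -> V) :
  inner (\sum_m a m *: w1 m) (\sum_k a k *: w2 k)
    = \sum_m \sum_k a m * a k * inner (w1 m) (w2 k).
Proof.
rewrite inner_suml; apply: eq_bigr => m _; rewrite linear_sum/=.
by apply: eq_bigr => k _; rewrite innerZl linearZ/= mulrA.
Qed.

Lemma cm_val_is_linear : linear (@cm_val R X C0).
Proof. by move=> a x y. Qed.

HB.instance Definition _ :=
  GRing.isLinear.Build R K X _ (@cm_val R X C0) cm_val_is_linear.

(** The functional <v, .>_X restricted to the Cameron-Martin space, as a
function on [K], whose topology is finer than that of [X]. *)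
Definition cm_pair v (a : K) : R := inner v (cm_val a).

Lemma cm_pair_is_scalar v : scalar (cm_pair v).
Proof. by move=> c a b; rewrite /cm_pair [cm_val _]linearP linearP. Qed.

HB.instance Definition _ v :=
  GRing.isLinear.Build R K R *%R (cm_pair v) (cm_pair_is_scalar v).

(** With S = C_0^{1/2} and a = S b one has <v, a>_X = <S v, b>_X and
|a|_K = |b|_X, so that |S v|_X is a bound for the functional. *)
Lemma cm_pair_continuous v : continuous (cm_pair v).
Proof.
apply/linear_bounded_continuous/linear_boundedP.
near=> M => a /=; rewrite /cm_pair -cov_inv_sqrtK.
have [_ sa _ _] := cov_sqrtP C0; rewrite -sa.
apply: (le_trans (norm_inner_le _ _)); rewrite ler_wpM2r//.
Unshelve. all: by end_near. Qed.

Definition dev u v (m : 'I_J) : R := cm_pair v (u m - emean u).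

(** C(u) v as an element of [K], so that its Cameron-Martin norm makes sense. *)
Definition cm_cov u v : K :=
  J%:R^-1 *: \sum_(m < J) dev u v m *: (u m - emean u).

Lemma cm_val_cov u v : cm_val (cm_cov u v) = empirical_cov u v.
Proof. by rewrite /cm_cov linearZ linear_sum. Qed.

Lemma inner_covE u v w :
  inner (empirical_cov u v) w = J%:R^-1 * \sum_m dev u v m * dev u w m.
Proof.
rewrite /empirical_cov innerZl inner_suml; congr (_ * _).
by apply: eq_bigr => m _; rewrite innerZl (innerC _ w).
Qed.

Lemma cov_sym u v w : inner (empirical_cov u v) w = inner (empirical_cov u w) v.
Proof. by rewrite !inner_covE; under eq_bigr do rewrite mulrC. Qed.

Lemma cov_quadE u v :
  inner (empirical_cov u v) v = J%:R^-1 * \sum_m dev u v m ^+ 2.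
Proof. by rewrite inner_covE; under eq_bigr do rewrite -expr2. Qed.

Lemma cov_quad_ge0 u v : 0 <= inner (empirical_cov u v) v.
Proof. by rewrite cov_quadE mulr_ge0// sumr_ge0// => m _; rewrite sqr_ge0. Qed.

Lemma sum_dev_eq0 u v : (0 < J)%N -> \sum_m dev u v m = 0.
Proof. by move=> J0; rewrite /dev -!linear_sum sum_sub_emean// !linear0. Qed.

Lemma dev_pairE u v m :
  dev u v m = cm_pair v (u m) - J%:R^-1 * \sum_k cm_pair v (u k).
Proof. by rewrite /dev linearB linearZ linear_sum. Qed.

Lemma empirical_cov_is_linear u : linear (empirical_cov u).
Proof.
move=> a v w; rewrite /empirical_cov scalerA mulrC -scalerA -scalerDr.
congr (_ *: _); rewrite scaler_sumr -big_split; apply: eq_bigr => m _.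
by rewrite innerDl innerZl scalerDl scalerA.
Qed.

HB.instance Definition _ u :=
  GRing.isLinear.Build R X X _ (empirical_cov u) (empirical_cov_is_linear u).

Lemma ensemble_span_sum u (I : finType) (c : I -> R) (w : I -> K) :
  (forall i, ensemble_span u (w i)) -> ensemble_span u (\sum_i c i *: w i).
Proof.
move=> /choice[d wE]; exists (fun j => \sum_i c i * d i j).
under eq_bigr => i _ do rewrite wE scaler_sumr.
rewrite exchange_big; apply: eq_bigr => j _; rewrite scaler_suml.
by apply: eq_bigr => i _; rewrite scalerA.
Qed.

Lemma ensemble_spanZ u c (a : K) :
  ensemble_span u a -> ensemble_span u (c *: a).
Proof.
by move=> ua; have := @ensemble_span_sum u 'I_1 (fun=> c) (fun=> a) (fun=> ua);
  rewrite big_ord1.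
Qed.

Lemma cm_cov_span u u' v : (0 < J)%N ->
  (forall j, ensemble_span u (u' j)) -> ensemble_span u (cm_cov u' v).
Proof.
move=> J0 u'u; rewrite /cm_cov sum_shift ?sum_dev_eq0//.
exact/ensemble_spanZ/ensemble_span_sum.
Qed.

(** * The operator norm and the constant [lambda_m] *)

Lemma lambda_m_ge0 (A : set K) : 0 <= lambda_m A.
Proof.
rewrite /lambda_m; set E := [set _ | _ in _].
have [->|/set0P E0] := eqVneq E set0; first by rewrite inf0.
by apply: lb_le_inf => // _ [v _ <-]; rewrite sqr_ge0.
Qed.

(** By homogeneity: the infimum defining [lambda_m] runs over normalized
vectors. *)
Lemma lambda_m_le u (a : K) : ensemble_span u a ->
  lambda_m (ensemble_span u) * `|cm_val a| ^+ 2 <= `|a| ^+ 2.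
Proof.
move=> ua; have [a0|a0] := eqVneq `|cm_val a| 0.
  by rewrite a0 expr0n mulr0 sqr_ge0.
have a_gt0 : 0 < `|cm_val a| by rewrite lt_def a0 normr_ge0.
rewrite -ler_pdivlMr ?exprn_gt0//.
apply: ge_inf; first by exists 0 => _ [b _ <-]; rewrite sqr_ge0.
exists (`|cm_val a|^-1 *: a); last first.
  by rewrite normrZ exprMn normfV normr_id exprVn mulrC.
split; first exact: ensemble_spanZ.
by rewrite linearZ/= normrZ normfV normr_id mulVf// expr1n.
Qed.

(** The supremum defining the operator norm is taken over a bounded set, hence
is an upper bound and not the default value of [sup]. *)
Lemma empirical_cov_bounded u v :
  `|empirical_cov u v| <=
    (J%:R^-1 * \sum_m `|cm_val (u m - emean u)| ^+ 2) * `|v|.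
Proof.
rewrite /empirical_cov normrZ ger0_norm ?invr_ge0//.
rewrite -mulrA ler_wpM2l ?invr_ge0//.
rewrite mulr_suml (le_trans (ler_norm_sum _ _ _))// ler_sum// => m _.
by rewrite normrZ expr2 mulrAC ler_wpM2r// mulrC norm_inner_le.
Qed.

Lemma empirical_cov_norm_ub (A : set K) u (a : K) : A a -> `|cm_val a| <= 1 ->
  `|empirical_cov u (cm_val a)| <= empirical_cov_norm A u.
Proof.
move=> Aa a1; apply: ub_le_sup; last first.
  by exists (cm_val a) => //; split => //; exists a.
exists (J%:R^-1 * \sum_m `|cm_val (u m - emean u)| ^+ 2) => _ [x [_ x1] <-].
apply: (le_trans (empirical_cov_bounded _ _)).
by rewrite ler_piMr// mulr_ge0 ?invr_ge0// sumr_ge0// => m _; rewrite sqr_ge0.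
Qed.

(** The norm of a nonnegative symmetric operator is the supremum of its
quadratic form. For |x|_X <= 1 and w = C x, which again lies in the span,
Cauchy-Schwarz for the form of C gives
|w|^4 = <C x, w>^2 <= <C x, x> <C w, w> <= M * (M |w|^2). *)
Lemma empirical_cov_norm_le u u' (M : R) : (0 < J)%N -> 0 <= M ->
  (forall j, ensemble_span u (u' j)) ->
  (forall a, ensemble_span u a -> `|cm_val a| = 1 ->
    inner (empirical_cov u' (cm_val a)) (cm_val a) <= M) ->
  empirical_cov_norm (ensemble_span u) u' <= M.
Proof.
move=> J0 M0 u'u qM.
have quad_le (a : K) : ensemble_span u a ->
    inner (empirical_cov u' (cm_val a)) (cm_val a) <= M * `|cm_val a| ^+ 2.
  move=> ua; have [a0|a0] := eqVneq `|cm_val a| 0.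
    by rewrite (normr0_eq0 a0) linear0 normr0 expr0n mulr0.
  have a_gt0 : 0 < `|cm_val a| by rewrite lt_def a0 normr_ge0.
  rewrite -ler_pdivrMr ?exprn_gt0//.
  have := qM (`|cm_val a|^-1 *: a) (ensemble_spanZ _ ua).
  rewrite !linearZ/= normrZ normfV normr_id mulVf// => /(_ erefl).
  by rewrite innerZl mulrA -expr2 exprVn mulrC.
rewrite /empirical_cov_norm /opnorm_on; apply: ge_sup.
  exists `|empirical_cov u' 0|; exists 0 => //; split; last by rewrite normr0.
  exists 0; last by rewrite linear0.
  by rewrite -(scale0r (u' (Ordinal J0))); exact: ensemble_spanZ.
move=> _ [_ [[a ua <-] a1] <-].
set x := cm_val a; set w := empirical_cov u' x.
have uw : ensemble_span u (cm_cov u' x) by exact: cm_cov_span.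
have wE : cm_val (cm_cov u' x) = w by exact: cm_val_cov.
have [w0|w0] := eqVneq `|w| 0; first by rewrite w0.
have w_gt0 : 0 < `|w| by rewrite lt_def w0 normr_ge0.
have CS : `|w| ^+ 2 ^+ 2 <= M ^+ 2 * `|w| ^+ 2.
  have := form_CauchySchwarz
    (b := fun v => inner (empirical_cov u' v) : {scalar X}) (cov_sym u')
    (cov_quad_ge0 u') x w.
  rewrite /= -/w -normr_inner => /le_trans; apply.
  rewrite expr2 -mulrA ler_pM ?cov_quad_ge0//; last by rewrite -wE quad_le.
  rewrite (le_trans (quad_le _ ua))// ler_piMr// expr_le1//.
move: CS; rewrite [_ ^+ 2 ^+ 2]expr2 ler_pM2r ?exprn_gt0//.
by rewrite ler_pXn2r ?nnegrE.
Qed.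

End Ensemble.

(** * Decay of the quadratic form along the flow *)

Section Flow.
Context {R : realType} {X Y : hilbertType R} {C0 : covOp X} {J : nat}.
Local Notation K := (cameronMartin C0).
Context (Gmh : {linear Y -> Y}) (G : K -> Y) (y : Y).

(** The left-hand side is half the derivative of <C v, v>. The weights a_m have
zero sum, so the shifts by [y], by the mean of the G(u_m) and by the mean of
the u_m disappear from the double sum of the a_m a_k E_mk, and the two terms of
E become squares; the misfit square is dropped. *)
Lemma teki_dissipation (u : 'I_J -> K) (v : X) : (0 < J)%N ->
  J%:R^-1 * \sum_m dev u v m *
    cm_pair v (teki_rhs Gmh G y u m) <= - `|cm_cov u v| ^+ 2.
Proof.
move=> J0; set a := dev u v; have a0 : \sum_m a m = 0 by exact: sum_dev_eq0.
pose g := \sum_m a m *: Gmh (G (u m)).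
pose w : K := \sum_m a m *: u m.
have sumE : \sum_m \sum_k a m * a k * teki_E Gmh G y u m k
    = inner g g + inner w w.
  have gE c : g = \sum_m a m *: (Gmh (G (u m)) - c) by rewrite sum_shift.
  have wE : w = \sum_m a m *: (u m - emean u) by rewrite sum_shift.
  rewrite {1}(gE (Gmh y)) (gE (Gmh (emean (G \o u)))) [in X in _ + inner _ X]wE.
  rewrite !inner_sum2.
  rewrite -big_split; apply: eq_bigr => m _; rewrite -big_split.
  by apply: eq_bigr => k _; rewrite -!linearB/= -mulrDr.
have rhsE m : a m * cm_pair v (teki_rhs Gmh G y u m)
    = - (J%:R^-1 * \sum_k a m * a k * teki_E Gmh G y u m k).
  rewrite [in LHS]linearN linearZ linear_sum/= mulrN mulrCA mulr_sumr.
  congr (- (_ * _)); apply: eq_bigr => k _.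
  by rewrite linearZ/= -/(dev u v k) -/a (mulrC _ (a k)) mulrA.
have covE : cm_cov u v = J%:R^-1 *: w.
  by rewrite /cm_cov -/a (sum_shift u (emean u) a0).
rewrite (eq_bigr _ (fun m _ => rhsE m)) sumrN -mulr_sumr sumE.
rewrite covE normrZ exprMn normr_inner real_normK ?num_real//.
rewrite mulrN mulrA -expr2 lerN2 ler_wpM2l ?sqr_ge0//.
by rewrite lerDr -normr_inner sqr_ge0.
Qed.

Context (I : set R) (u : R -> 'I_J -> K) (v : X).
Context (J_gt0 : (0 < J)%N) (u_sol : teki_solution Gmh G y I u).

Let q s := inner (empirical_cov (u s) v) v.

(** Applying the continuous functional <v, .>_X to the flow turns it into scalar
equations. *)
Lemma cm_pair_slope s m : I s ->
  (r - s)^-1 *: (cm_pair v (u r m) - cm_pair v (u s m)) @[r --> within I s^']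
    --> cm_pair v (teki_rhs Gmh G y (u s) m).
Proof.
move=> Is.
have := cvg_comp _ _ (u_sol Is (j := m)) (@cm_pair_continuous _ _ _ v _).
apply: cvg_trans; apply: near_eq_cvg; apply: nearW => r /=.
by rewrite linearZ linearB.
Qed.

(** The quadratic form in terms of the differentiable functions <v, u_m(s)>,
written with the operations on functions on which the rules of derivation are
stated. *)
Lemma cov_quad_pairE : q = J%:R^-1 \*: \sum_(m < J)
   (cm_pair v \o u^~ m - J%:R^-1 \*: \sum_(k < J) (cm_pair v \o u^~ k)) ^+ 2.
Proof.
apply/funext => s; rewrite /q cov_quadE /= fct_sumE; congr (_ * _).
by apply: eq_bigr => m _; rewrite dev_pairE !expr2/= fct_sumE.
Qed.

Lemma cov_quad_continuous t : `[0, t] `<=` I -> {within `[0, t], continuous q}.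
Proof.
move=> tI; apply/subspace_continuousP => s st; have Is := tI _ st.
have fC m : cm_pair v (u r m) @[r --> within `[0, t] (nbhs s)]
    --> cm_pair v (u s m).
  have := cvg_slope_continuous (cm_pair_slope (m := m) Is).
  apply: cvg_trans; apply: cvg_app.
  move=> B; change (nbhs s [set r | I r -> B r] ->
    nbhs s [set r | `[0, t]%classic r -> B r]).
  by apply: filterS => r IB tr; exact/IB/tI.
have -> : q = fun r => J%:R^-1 * \sum_m
    (cm_pair v (u r m) - J%:R^-1 * \sum_k cm_pair v (u r k)) ^+ 2.
  apply/funext => r; rewrite /q cov_quadE; congr (_ * _).
  by apply: eq_bigr => m _; rewrite dev_pairE.
apply: cvgM; first exact: cvg_cst.
apply: (cvg_big add_continuous) => m _; rewrite /= expr2.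
have dC : cm_pair v (u r m) - J%:R^-1 * \sum_k cm_pair v (u r k)
    @[r --> within `[0, t] (nbhs s)] -->
    cm_pair v (u s m) - J%:R^-1 * \sum_k cm_pair v (u s k).
  apply: cvgB; first exact: fC.
  apply: cvgM; first exact: cvg_cst.
  by apply: (cvg_big add_continuous) => k _; exact: fC.
exact: (cvgM dC dC).
Qed.

Lemma cov_quad_derive s : nbhs s I ->
  exists2 dq, is_derive s 1 q dq & dq <= - (2 * `|cm_cov (u s) v| ^+ 2).
Proof.
move=> sI; have Is := nbhs_singleton sI.
pose da m := cm_pair v (teki_rhs Gmh G y (u s) m).
have Da m : is_derive s 1 (cm_pair v \o u^~ m) (da m).
  exact: cvg_slope_is_derive (cm_pair_slope (m := m) Is).
exists (J%:R^-1 * (2 * \sum_m dev (u s) v m * da m)).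
  rewrite cov_quad_pairE; apply: is_derive_eq.
  have devE i : (cm_pair v \o u^~ i
      - J%:R^-1 \*: \sum_(k < J) (cm_pair v \o u^~ k)) s = dev (u s) v i.
    by rewrite dev_pairE fct_sumE.
  (* the motion of the mean meets weights of zero sum *)
  under eq_bigr do rewrite devE expr1 /GRing.scale/= -mulrA mulrBr.
  rewrite -mulr_sumr sumrB -mulr_suml sum_dev_eq0// mul0r subr0.
  by [].
rewrite mulrCA -mulrN ler_pM2l//.
exact: teki_dissipation.
Qed.

End Flow.

Theorem theorem3p5 (R : realType) (X Y : hilbertType R)
  (sepX : separable X) (sepY : separable Y)
  (y : Y) (J : nat) (J_gt0 : (0 < J)%N)
  (Gam Gmh : {linear Y -> Y})
  (Gam_bounded : bounded_op Gam) (Gam_sa : self_adjoint Gam)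
  (Gam_pos : strictly_positive Gam)
  (GmhE : is_inv_sqrt_op Gmh Gam) (Gmh_bounded : bounded_op Gmh)
  (C0 : covOp X)
  (G : cameronMartin C0 -> Y) (G_C1 : C1 G)
  (I : set R) (I_itv : is_interval I) (I0 : I 0)
  (I_ge0 : forall s, I s -> 0 <= s)
  (u : R -> 'I_J -> cameronMartin C0)
  (u_sol : teki_solution Gmh G y I u)
  (u_span : forall s, I s -> forall j, ensemble_span (u 0) (u s j))
  (C_neq0 : exists v, empirical_cov (u 0) v <> 0) :
  let A := ensemble_span (u 0) in
  forall t, I t ->
    empirical_cov_norm A (u t)
      <= 1 / ((empirical_cov_norm A (u 0))^-1 + 2 * lambda_m A * t).
Proof.
move=> A t It.
have uA : forall s, I s -> forall j, A (u s j) by exact: u_span.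
have t0 : 0 <= t by exact: I_ge0.
have tI : `[0, t] `<=` I.
  by move=> s /=; rewrite in_itv/= => st; exact: I_itv I0 It _ st.
have N_gt0 : 0 < empirical_cov_norm A (u 0).
  (* If a = C v is nonzero, so is C a, because <C a, v> = <C v, a> = |a|^2;
     and a lies in A, even when v does not. *)
  have [v Cv0] := C_neq0.
  set a := cm_cov (u 0) v.
  have Aa : A a by apply: cm_cov_span => // j; exact: uA.
  have aE : cm_val a = empirical_cov (u 0) v by exact: cm_val_cov.
  have a_gt0 : 0 < `|cm_val a| by rewrite normr_gt0 aE; exact/eqP.
  have Ab : A (`|cm_val a|^-1 *: a) by exact: ensemble_spanZ.
  apply: lt_le_trans (empirical_cov_norm_ub _ Ab _); last first.
    by rewrite linearZ/= normrZ normfV normr_id mulVf// gt_eqF.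
  rewrite normr_gt0 linearZ linearZ/= scaler_eq0 negb_or invr_eq0 gt_eqF//=.
  apply: contraTneq a_gt0 => Ca0.
  have := cov_sym (u 0) v (cm_val a); rewrite Ca0 -aE -normr_inner.
  rewrite -(scale0r (0 : X)) innerZl mul0r => /eqP.
  by rewrite sqrf_eq0 => /eqP ->; rewrite ltxx.
have lam0 := lambda_m_ge0 A.
apply: empirical_cov_norm_le => //; [|exact: uA|].
  by rewrite mul1r invr_ge0 addr_ge0 ?invr_ge0 ?mulr_ge0// ltW.
move=> a Aa a1; set v := cm_val a.
have tI' s : s \in `]0, t[ -> nbhs s I.
  move=> st; have : nbhs s `]0, t[%classic by exact: near_in_itvoo.
  apply: filterS => r /= rt; apply: tI => /=.
  exact: subset_itv_oo_cc rt.
apply: (@riccati_le _ (fun s => inner (empirical_cov (u s) v) v)) => //.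
- by rewrite mulr_ge0.
- exact: cov_quad_continuous u_sol _ tI.
- move=> s st; have Is := nbhs_singleton (tI' s st).
  have [dq Dq dq_le] := cov_quad_derive v J_gt0 u_sol (tI' s st).
  exists dq => //; apply: le_trans dq_le _.
  rewrite lerN2 -mulrA ler_pM2l//.
  have Ac : A (cm_cov (u s) v) by apply: cm_cov_span => // j; exact: uA.
  apply: le_trans (lambda_m_le Ac); rewrite ler_wpM2l//.
  have := norm_inner_le (empirical_cov (u s) v) v.
  rewrite a1 mulr1 -cm_val_cov => le_norm.
  by rewrite -real_normK ?num_real// ler_pXn2r ?nnegrE.
- apply: le_trans (ler_norm _) _; apply: le_trans (norm_inner_le _ _) _.
  by rewrite a1 mulr1; apply: empirical_cov_norm_ub => //; rewrite a1.
Qed.
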